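(* Let $A$ be the state space of a model, $A_0\subseteq A$ the initial states, $f:A\to A$ the dynamic and $y:A\to\mathbb{R}^m$ the observer. Let $D$ be the closed observable space, and let $\phi\in C^2(A,D)$ (coordinate transformation), $G\in C^2(D,D)$ (dynamic) and $\tilde y\in C^2(D,\mathbb{R}^m)$ (observer) be the exact objects of the closed-observable model, so that $\tilde y(G^n(\phi(a)))=y(f^n(a))$ for all $a\in A_0$ and $n\in\mathbb{N}$. Let $\phi_I\in C^2(A,D)$, $G_I\in C^2(D,D)$ and $\tilde y_I\in C^2(D,\mathbb{R}^m)$ be interpolants of $\phi,G,\tilde y$ with maximal errors $E_\phi$, $E_G$, $E_{\tilde y}$ on the respective domains, whose norms are small (much smaller than one). Suppose there is a constant $M\in(0,1)$ with $\sup_{\phi\in D}\|DG(\phi)\|\le M$. Then there are positive constants $C_1,C_2,C_3$, independent of $n$ and $a_0$, such that for every initial state $a_0\in A_0$ and every fixed number of iterations $n\in\mathbb{N}$, $$\big\|y\left(f^na_0\right)-\tilde y_I\left(G_I^n\phi_I(a_0)\right)\big\|\le C_1\left(\frac{1-M^{n+1}}{1-M}\right)\|E_G\|+C_2M^n\|E_\phi\|+C_3\|E_{\tilde y}\|.$$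
   Context: $A$ and $D$ are (normed) vector spaces, with $D$ a Euclidean space. Powers denote iteration: $f^n$, $G^n$, $G_I^n$ are $n$-fold compositions, and $DG$ is the derivative of $G$, measured in operator norm. The maximal interpolation errors are measured by $$\|E_\phi\|=\max_{a\in A}\|\phi_I(a)-\phi(a)\|,\qquad \|E_G\|=\max_{\phi\in D}\|G_I(\phi)-G(\phi)\|,\qquad \|E_{\tilde y}\|=\max_{\phi\in D}\|\tilde y_I(\phi)-\tilde y(\phi)\|,$$ all assumed finite. ''Much smaller than one'' means in particular $\|E_\phi\|,\|E_G\|,\|E_{\tilde y}\|<1$.
   Formalization: The formal theorem also assumes that, for every r, the derivative of ỹ is bounded on the r-neighbourhood of the exact orbits {G^n(φ(a)) : a in A_0, n in N}; without this the claim fails, e.g. G(x)=x/2, φ=id, ỹ(x)=x², φ_I(x)=x+1/2 on A_0=R. *)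

(* Defs.v *)
From HB Require Import structures.
From mathcomp Require Import all_boot all_order all_algebra.
From mathcomp Require Import sesquilinear ring.
From mathcomp Require Import all_classical all_reals all_analysis.

Set Implicit Arguments.
Unset Strict Implicit.
Unset Printing Implicit Defensive.
Import Order.TTheory GRing.Theory Num.Theory.
Import numFieldNormedType.Exports.
Local Open Scope classical_set_scope.
Local Open Scope ring_scope.

(* R^n with the Euclidean norm.  An alias of 'rV[R]_n is needed because the
   normed module structure of 'rV[R]_n itself is that of the maximum norm. *)
Definition euclid (R : realType) (n : nat) : Type := 'rV[R]_n.

HB.instance Definition _ (R : realType) (n : nat) :=
  GRing.Lmodule.copy (euclid R n) 'rV[R]_n.

Section EuclideanNorm.
Variables (R : realType) (n : nat).
Implicit Types x y : euclid R n.

Definition enorm (x : euclid R n) : R :=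
  Num.sqrt (\sum_i (x : 'rV[R]_n) 0 i ^+ 2).

Lemma enorm_ge0 x : 0 <= enorm x.
Proof. exact: sqrtr_ge0. Qed.

Lemma sqr_enorm x : enorm x ^+ 2 = \sum_i (x : 'rV[R]_n) 0 i ^+ 2.
Proof. by rewrite sqr_sqrtr// sumr_ge0// => i _; exact: sqr_ge0. Qed.

Lemma enormZ (l : R) x : enorm (l *: x) = `|l| * enorm x.
Proof.
rewrite /enorm -sqrtr_sqr -sqrtrM ?sqr_ge0// mulr_sumr; congr Num.sqrt.
by apply: eq_bigr => i _; rewrite mxE exprMn.
Qed.

Lemma enorm0_eq0 x : enorm x = 0 -> x = 0.
Proof.
move=> x0; have := sqr_enorm x; rewrite x0 expr0n /= => /esym/eqP.
rewrite psumr_eq0 => [/allP h|i _]; last exact: sqr_ge0.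
apply/matrixP => i j; rewrite ord1 mxE.
by have := h j (mem_index_enum j); rewrite /= sqrf_eq0 => /eqP.
Qed.

Lemma dot_le_enorm x y :
  \sum_i (x : 'rV[R]_n) 0 i * (y : 'rV[R]_n) 0 i <= enorm x * enorm y.
Proof.
have [x0|x0] := eqVneq (enorm x) 0.
  rewrite x0 mul0r big1// => i _.
  by rewrite (enorm0_eq0 x0) mxE mul0r.
have [y0|y0] := eqVneq (enorm y) 0.
  rewrite y0 mulr0 big1// => i _.
  by rewrite (enorm0_eq0 y0) mxE mulr0.
have a0 : 0 < enorm x by rewrite lt_def x0 enorm_ge0.
have b0 : 0 < enorm y by rewrite lt_def y0 enorm_ge0.
set a := enorm x in a0 *; set b := enorm y in b0 *.
have : 0 <= \sum_i (b * (x : 'rV[R]_n) 0 i - a * (y : 'rV[R]_n) 0 i) ^+ 2.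
  by apply: sumr_ge0 => i _; exact: sqr_ge0.
rewrite (eq_bigr (fun i => b ^+ 2 * (x : 'rV[R]_n) 0 i ^+ 2
   + a ^+ 2 * (y : 'rV[R]_n) 0 i ^+ 2
   - (a * b) *+ 2 * ((x : 'rV[R]_n) 0 i * (y : 'rV[R]_n) 0 i))); last first.
  by move=> i _; ring.
rewrite sumrB big_split/= -!mulr_sumr -!sqr_enorm -/a -/b.
set s := (X in _ *+ 2 * X).
have -> : b ^+ 2 * a ^+ 2 + a ^+ 2 * b ^+ 2 - (a * b) *+ 2 * s
  = ((a * b) *+ 2) * (a * b - s) by ring.
by rewrite pmulr_rge0 ?subr_ge0// pmulrn_lgt0 ?mulr_gt0.
Qed.

Lemma ler_enormD x y : enorm (x + y) <= enorm x + enorm y.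
Proof.
rewrite -(@ler_pXn2r _ 2%N) ?nnegrE ?addr_ge0 ?enorm_ge0//.
rewrite sqr_enorm (eq_bigr (fun i => (x : 'rV[R]_n) 0 i ^+ 2
   + (y : 'rV[R]_n) 0 i ^+ 2
   + ((x : 'rV[R]_n) 0 i * (y : 'rV[R]_n) 0 i) *+ 2)); last first.
  by move=> i _; rewrite mxE; ring.
rewrite !big_split/= -!sqr_enorm -mulr2n sqrrD addrAC lerD2r lerD2l.
by rewrite lerMn2r dot_le_enorm orbT.
Qed.

HB.instance Definition _ := Lmodule_isNormed.Build R (euclid R n)
  ler_enormD enormZ enorm0_eq0.

End EuclideanNorm.

Section Norms.
Variable R : realType.
Local Open Scope ereal_scope.

Definition supnorm (T : Type) (W : normedModType R) (e : T -> W) : \bar R :=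
  ereal_sup [set `|e t|%R%:E | t in [set: T]].

Definition opnorm (V W : normedModType R) (L : V -> W) : \bar R :=
  ereal_sup [set `|L v|%R%:E | v in [set v : V | (`|v| <= 1)%R]].

Definition supdiff (V W : normedModType R) (S : set V) (g : V -> W) : \bar R :=
  ereal_sup [set opnorm ('d g x) | x in S].

End Norms.

(* The spaces of bounded linear and bilinear maps are not available as normed
   modules, so the second derivative is given as a map B from V to bilinear
   maps: B x is the Frechet derivative at x of the map x |-> 'd f x with
   respect to the operator norm, and B is continuous. *)
Definition is_C2 (R : realType) (V W : normedModType R) (f : V -> W) : Prop :=
  (forall x, differentiable f x) /\
  exists B : V -> {bilinear V -> V -> W},
    [/\ forall x, exists k : R, forall u v, `|B x u v| <= k * `|u| * `|v|,
        forall x (e : R), 0 < e -> \forall h \near (0 : V),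
          (opnorm (fun v => 'd f (x + h) v - 'd f x v - B x h v)%R
             <= (e * `|h|)%:E)%E
      & forall x (e : R), 0 < e -> \forall z \near x, forall u,
          (opnorm (fun v => B z u v - B x u v)%R <= (e * `|u|)%:E)%E].

Definition tube (R : realType) (T : Type) (V : normedModType R)
    (A0 : set T) (phi : T -> V) (G : V -> V) (r : R) : set V :=
  [set z | exists a n, A0 a /\ `|z - iter n G (phi a)| <= r].

(* Main.v *)
Require Import Defs.
From mathcomp Require Import all_boot all_order all_algebra.
From mathcomp Require Import ring lra.
From mathcomp Require Import all_classical all_reals all_analysis.
Import Order.TTheory GRing.Theory Num.Theory.
Import numFieldNormedType.Exports.
Local Open Scope classical_set_scope.
Local Open Scope ring_scope.

(** Write w_n = G^n(phi a0) and z_n = GI^n(phiI a0) for the exact and the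
    interpolated orbit in the observable space.  By the closure hypothesis
    y(f^n a0) = yt(w_n), so the quantity to bound is the distance between
    yt(w_n) and ytI(z_n).

    Since the derivative of G has norm at most M everywhere, the mean value
    inequality ([le_norm_supdiff]) makes G an M-Lipschitz map.  Each step of the
    interpolated orbit commits a fresh error of at most the norm of E_G, and
    contracts the errors committed before by M; summing the geometric series
    ([iter_perturbation]) gives
      |z_n - w_n| <= (1 - M^n) / (1 - M) * |E_G| + M^n * |E_phi|.

    As the interpolation errors are smaller than one, this is at most
    r = 1 / (1 - M) + 1 for every n: the whole segment from w_n to z_n stays in
    the tube of radius r around the exact orbits, where the derivative of yt is
    bounded by some K.  Applying the mean value inequality to yt on this segment
    costs a factor K, which gives C1 = C2 = K, and replacing yt by ytI at z_n
    costs |E_yt|, so C3 = 1. *)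

Section MeanValueInequality.
Variables (R : realType) (V W : normedModType R).

Lemma le_supnorm (T : Type) (e : T -> W) t : (`|e t|%:E <= supnorm e)%E.
Proof. by apply: ereal_sup_ubound; exists t. Qed.

Lemma le_opnorm (L : {linear V -> W}) (K : R) v :
  (opnorm L <= K%:E)%E -> `|L v| <= K * `|v|.
Proof.
move=> LK; have [->|v0] := eqVneq v 0; first by rewrite linear0 !normr0 mulr0.
have nv : 0 < `|v| by rewrite normr_gt0.
rewrite -ler_pdivrMr// -lee_fin; apply: le_trans LK.
apply: ereal_sup_ubound; exists (`|v|^-1 *: v) => /=.
  by rewrite normrZ normfV normr_id mulVf// gt_eqF.
by rewrite linearZ normrZ normfV normr_id mulrC.
Qed.

(** The derivative controls increments only near each point, up to an
    arbitrarily small loss [e] in the constant. *)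
Lemma differentiable_local_lipschitz (g : V -> W) (x : V) (K e : R) :
  differentiable g x -> (opnorm ('d g x) <= K%:E)%E -> 0 < e ->
  exists2 r : R, 0 < r &
    forall h, `|h| < r -> `|g (x + h) - g x| <= (K + e) * `|h|.
Proof.
move=> dg gK e0.
have /eqaddoP /(_ e e0) := diff_locally dg.
move=> /nbhs_norm0P[r /= r0 hr]; exists r => // h hlt.
have /= := hr h hlt; rewrite /= !fctE /= => hh.
rewrite mulrDl.
have -> : g (x + h) - g x = 'd g x h + (g (x + h) - (g x + 'd g x h)).
  by rewrite opprD (addrA (g _)) [RHS]addrC subrK.
by rewrite (le_trans (ler_normD _ _))// lerD ?le_opnorm// (addrC x).
Qed.

(** The target is an arbitrary normed space, so the scalar mean value theorem
    does not apply.  Instead, fix [e > 0] and let [c] be the supremum of the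
    times [t] in [0, 1] at which the increment satisfies the inequality with the
    slightly larger slope [K + e].  The local estimate at time [c] shows,
    backwards, that [c] itself is such a time and, forwards, that it would not
    be an upper bound if it were smaller than [1]. *)
Lemma le_norm_segment (g : V -> W) (x v : V) (K : R) :
  (forall t : R, 0 <= t <= 1 -> differentiable g (x + t *: v)) ->
  (forall t : R, 0 <= t <= 1 -> (opnorm ('d g (x + t *: v)%R) <= K%:E)%E) ->
  `|g (x + v) - g x| <= K * `|v|.
Proof.
move=> dg gK.
have [->|v0] := eqVneq v 0; first by rewrite addr0 subrr !normr0 mulr0.
have nv : 0 < `|v| by rewrite normr_gt0.
rewrite -ler_pdivrMr//; apply/ler_addgt0Pr => e e0; rewrite ler_pdivrMr//.
set C := (K + e) * `|v|.
pose S : set R := [set t | 0 <= t <= 1 /\ `|g (x + t *: v) - g x| <= C * t].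
have S0 : S 0 by split; rewrite ?lexx ?ler01// scale0r addr0 subrr normr0 mulr0.
have S1 : ubound S 1 by move=> t [/andP[]].
have supS : has_sup S by split; [exists 0 | exists 1].
set c := sup S.
have c01 : 0 <= c <= 1.
  by rewrite (ub_le_sup supS.2 S0) (sup_le_ub supS.1 S1).
have [r r0 hr] := differentiable_local_lipschitz _ _ _ _ (dg _ c01) (gK _ c01) e0.
pose q := r / `|v|.
have q0 : 0 < q by rewrite divr_gt0.
have step (s : R) : `|s - c| < q ->
    `|g (x + s *: v) - g (x + c *: v)| <= C * `|s - c|.
  move=> sc; have := hr ((s - c) *: v).
  rewrite -addrA -scalerDl (addrC c) subrK normrZ -ltr_pdivlMr// => /(_ sc).
  by rewrite /C -mulrA (mulrC `|v|).
have gc : `|g (x + c *: v) - g x| <= C * c.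
  have [t St ct] := sup_adherent q0 supS.
  have tc : t <= c := ub_le_sup supS.2 St.
  have ntc : `|t - c| = c - t by rewrite distrC ger0_norm ?subr_ge0.
  have := step t; rewrite ntc => /(_ ltac:(rewrite -/c in ct; lra)) h1.
  rewrite (le_trans (ler_distD (g (x + t *: v)) _ _))// distrC.
  by apply: le_trans (lerD h1 St.2) _; rewrite -mulrDr subrK.
have [c1|c1] := eqVneq c 1.
  by move: gc; rewrite c1 scale1r mulr1.
have {}c1 : c < 1 by rewrite lt_neqAle c1; case/andP: c01.
(* a time of [0, 1] after [c] at which the estimate at [c] still applies *)
pose s := Num.min 1 (c + q / 2).
have cs : c < s by rewrite lt_min c1/= ltrDl divr_gt0.
have sq : s <= c + q / 2 by rewrite ge_min lexx orbT.
have nsc : `|s - c| = s - c by rewrite ger0_norm// subr_ge0 ltW.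
suff /(ub_le_sup supS.2) : S s by rewrite leNgt cs.
split; first by rewrite ge_min lexx andbT (le_trans _ (ltW cs))//; case/andP: c01.
have := step s; rewrite nsc => /(_ ltac:(lra)) h1.
rewrite (le_trans (ler_distD (g (x + c *: v)) _ _))//.
by apply: le_trans (lerD h1 gc) _; rewrite -mulrDr subrK.
Qed.

Lemma le_norm_supdiff (S : set V) (g : V -> W) (K : R) (x z : V) :
  (forall u, differentiable g u) -> (supdiff S g <= K%:E)%E ->
  (forall t : R, 0 <= t <= 1 -> S (x + t *: (z - x))) ->
  `|g z - g x| <= K * `|z - x|.
Proof.
move=> dg gK Sxz; have -> : g z = g (x + (z - x)) by rewrite addrC subrK.
apply: le_norm_segment => // t t01; apply: le_trans gK.
by apply: ereal_sup_ubound; exists (x + t *: (z - x)) => //; exact: Sxz.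
Qed.

End MeanValueInequality.

(** One step gives err_{n+1} <= e + M * err_n: compare [H] with [G] at the same
    point, then contract by [G].  The right-hand side solves this recursion with
    equality. *)
Lemma iter_perturbation (R : realType) (V : normedModType R) (G H : V -> V)
    (M e : R) (u v : V) (n : nat) :
  0 <= M -> M < 1 ->
  (forall x z, `|G z - G x| <= M * `|z - x|) ->
  (forall z, `|H z - G z| <= e) ->
  `|iter n H u - iter n G v| <= (1 - M ^+ n) / (1 - M) * e + M ^+ n * `|u - v|.
Proof.
move=> M0 M1 GM He; elim: n => [|n IH].
  by rewrite !expr0 subrr !mul0r add0r mul1r.
rewrite !iterS (le_trans (ler_distD (G (iter n H u)) _ _))//.
apply: le_trans (lerD (He _) (le_trans (GM _ _) (ler_wpM2l M0 IH))) _.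
rewrite le_eqVlt; apply/orP; left; apply/eqP; rewrite exprS; field.
by rewrite gt_eqF// subr_gt0.
Qed.

Lemma tube_segment (R : realType) (T : Type) (V : normedModType R)
    (A0 : set T) (phi : T -> V) (G : V -> V) (r : R) (a : T) (n : nat)
    (z : V) (t : R) :
  A0 a -> `|z - iter n G (phi a)| <= r -> 0 <= t <= 1 ->
  tube A0 phi G r (iter n G (phi a) + t *: (z - iter n G (phi a))).
Proof.
move=> A0a zr /andP[t0 t1]; exists a, n; split => //.
rewrite addrC addKr normrZ ger0_norm//.
by apply: le_trans zr; rewrite ler_piMl.
Qed.

(** The point [t] excludes the value [-oo], the supremum over an empty type. *)
Lemma supnorm_fin_num (R : realType) (T : Type) (W : normedModType R)
    (e : T -> W) (t : T) :
  (supnorm e < 1)%E -> exists2 k : R, supnorm e = k%:E & 0 <= k < 1.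
Proof.
move=> e1; have e0 : (0 <= supnorm e)%E.
  by apply: le_trans (le_supnorm _ _ _ e t); rewrite lee_fin.
case: (supnorm e) e0 e1 => [k| |]//; rewrite lee_fin lte_fin => k0 k1.
by exists k => //; rewrite k0.
Qed.

Theorem theorem2 (R : realType) (d m : nat) (A : normedModType R)
  (A0 : set A) (f : A -> A) (y : A -> euclid R m)
  (phi phiI : A -> euclid R d)
  (G GI : euclid R d -> euclid R d)
  (yt ytI : euclid R d -> euclid R m)
  (M : R) :
  is_C2 phi -> is_C2 G -> is_C2 yt ->
  (forall a n, A0 a -> yt (iter n G (phi a)) = y (iter n f a)) ->
  is_C2 phiI -> is_C2 GI -> is_C2 ytI ->
  (supnorm (fun a => phiI a - phi a)%R < 1)%E ->
  (supnorm (fun z => GI z - G z)%R < 1)%E ->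
  (supnorm (fun z => ytI z - yt z)%R < 1)%E ->
  0 < M -> M < 1 ->
  (supdiff setT G <= M%:E)%E ->
  (forall r : R, supdiff (tube A0 phi G r) yt < +oo)%E ->
  exists C1 C2 C3 : R, [/\ 0 < C1, 0 < C2, 0 < C3 &
    forall (a0 : A) (n : nat), A0 a0 ->
      ((`|y (iter n f a0) - ytI (iter n GI (phiI a0))|%R)%:E <=
         (C1 * ((1 - M ^+ n.+1) / (1 - M)))%:E
           * supnorm (fun z => GI z - G z)%R
         + (C2 * M ^+ n)%:E * supnorm (fun a => phiI a - phi a)%R
         + C3%:E * supnorm (fun z => ytI z - yt z)%R)%E].
Proof.
move=> _ [dG _] [dyt _] closed _ _ _ Ephi1 EG1 Eyt1 M0 M1 GM ytfin.
have [ep Ep /andP[ep0 ep1]] := supnorm_fin_num _ _ _ _ 0 Ephi1.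
have [eg Eg /andP[eg0 eg1]] := supnorm_fin_num _ _ _ _ 0 EG1.
have [ey Ey _] := supnorm_fin_num _ _ _ _ 0 Eyt1.
have phiE a : `|phiI a - phi a| <= ep.
  by rewrite -lee_fin -Ep (le_supnorm _ _ _ (fun a => phiI a - phi a)).
have GE z : `|GI z - G z| <= eg.
  by rewrite -lee_fin -Eg (le_supnorm _ _ _ (fun z => GI z - G z)).
have ytE z : `|ytI z - yt z| <= ey.
  by rewrite -lee_fin -Ey (le_supnorm _ _ _ (fun z => ytI z - yt z)).
have GL x z : `|G z - G x| <= M * `|z - x|.
  exact: (@le_norm_supdiff _ _ _ setT).
have M1' : 0 < 1 - M by rewrite subr_gt0.
pose r := (1 - M)^-1 + 1.
have [K K0 ytK] : exists2 K : R, 0 < K &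
    (supdiff (tube A0 phi G r) yt <= K%:E)%E.
  (* the supremum is [-oo] when there is no initial state *)
  case: (supdiff _ _) (ytfin r) => [k| |]// _; last by exists 1; rewrite ?leNye.
  exists (`|k| + 1); first by rewrite ltr_wpDl.
  by rewrite lee_fin (le_trans (ler_norm k))// lerDl.
exists K, K, 1; split => // a n A0a.
rewrite Ep Eg Ey -!EFinM -!EFinD lee_fin mul1r -closed//.
set w := iter n G (phi a); set z := iter n GI (phiI a).
have Mn0 : 0 <= M ^+ n by rewrite exprn_ge0// ltW.
have Mn1 : M ^+ n <= 1 by rewrite exprn_ile1// ltW.
have zw : `|z - w| <= (1 - M ^+ n) / (1 - M) * eg + M ^+ n * ep.
  apply: le_trans (iter_perturbation _ _ _ _ _ _ _ _ _ (ltW M0) M1 GL GE) _.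
  by rewrite lerD2l ler_wpM2l.
have zr : `|z - w| <= r.
  apply: le_trans zw _; apply: lerD; last by rewrite mulr_ile1// ltW.
  rewrite mulrAC ler_piMl ?invr_ge0 ?(ltW M1')//.
  by rewrite mulr_ile1 ?subr_ge0 ?lerBlDr ?lerDl// ltW.
have ytzw : `|yt z - yt w| <= K * `|z - w|.
  by apply: (le_norm_supdiff _ _ _ _ _ _ _ _ dyt ytK) => t; apply: tube_segment.
rewrite (le_trans (ler_distD (yt z) _ _))//.
rewrite (distrC (yt z)) (distrC (yt w)) lerD//.
(* enlarge the geometric sum by one term, from [n] to [n.+1] *)
apply: le_trans ytzw _; rewrite -!mulrA -mulrDr ler_pM2l//.
apply: le_trans zw _; rewrite mulrA lerD2r ler_wpM2r// ler_pM2r ?invr_gt0//.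
by rewrite lerD2l lerN2 exprS ler_piMl// ltW.
Qed.
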